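(* Let $G$ be a connected graph without loops, let $a,b\in V(G)$ be vertices of $G$, and let $\ell\ge 3$ be an integer. Then the pair of simplicial complexes $(K_\ell(a,b),K'_\ell(a,b))$ satisfies \[ C_\ast(K_\ell(a,b),K'_\ell(a,b))\cong MC_{\ast+2,\ell}(a,b) \] as chain complexes. In particular, \[ MH_{k,\ell}(a,b)\cong H_{k-2}(K_\ell(a,b),K'_\ell(a,b))\qquad\text{for all } k\ge 3. \] Moreover, for $k=2$, \[ MH_{2,\ell}(a,b)\cong\begin{cases}H_0(K_\ell(a,b),K'_\ell(a,b)) & \text{if } d(a,b)<\ell,\\ \tilde H_0(K_\ell(a,b)) & \text{if } d(a,b)=\ell,\end{cases} \] where $\tilde H_\ast$ denotes reduced homology.
   Context: A graph $G$ has a vertex set $V(G)$ and an edge set $E(G)$ of 2-element subsets of $V(G)$ (no loops, no multiple edges; not necessarily finite). $d$ is the shortest-path distance on $V(G)$. For a tuple $\mathbf{x}=(x_0,\dots,x_k)\in V(G)^{k+1}$ put $\mathrm{L}(\mathbf{x})=\sum_{i=0}^{k-1}d(x_i,x_{i+1})$. Magnitude chain complex: $MC_{k,\ell}(a,b)$ ($k\ge 0$) is the free $\mathbb{Z}$-module generated by the tuples $(x_0,\dots,x_k)\in V(G)^{k+1}$ with $x_0=a$, $x_k=b$, $x_j\ne x_{j+1}$ for all $0\le j\le k-1$, and $\mathrm{L}(x_0,\dots,x_k)=\ell$. The differential is $\partial=\sum_{i=1}^{k-1}(-1)^i\partial_i$, where $\partial_i(x_0,\dots,x_k)=(x_0,\dots,\hat{x}_i,\dots,x_k)$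 (removal of $x_i$) if $d(x_{i-1},x_{i+1})=d(x_{i-1},x_i)+d(x_i,x_{i+1})$, and $\partial_i(x_0,\dots,x_k)=0$ otherwise. $MH_{k,\ell}(a,b)$ is the $k$-th homology group of $MC_{\ast,\ell}(a,b)$. Shift: $MC_{\ast+2,\ell}(a,b)$ is the chain complex $D_\ast$ with $D_i=MC_{i+2,\ell}(a,b)$ for $i\ge 0$ and $D_i=0$ for $i<0$; its differential $D_i\to D_{i-1}$ is that of $MC_{\ast,\ell}(a,b)$ in degree $i+2$ for $i\ge 1$, and is $0$ for $i\le 0$. Paths: a path is a tuple $(x_0,\dots,x_k)\in V(G)^{k+1}$, $k\ge 1$, with $d(x_i,x_{i+1})=1$ for all $0\le i\le k-1$. $P_{\le\ell}(a,b)$ is the set of paths $(x_0,\dots,x_k)$ with $x_0=a$, $x_k=b$ and $k\le\ell$. Simplicial complexes: a simplicial complex is a set of nonempty finite sets closed under taking nonempty subsets (it may be empty). $K_\ell(a,b)$ is the simplicial complex whose simplices are the nonempty subsets $\{(x_{i_1},i_1),\dots,(x_{i_k},i_k)\}\subset V(G)\times\{1,\dots,\ell-1\}$, $i_1<\dots<i_k$, for which there is a path $(a,x_1,\dots,x_{\ell'-1},b)\in P_{\le\ell}(a,b)$ (of some length $\ell'\le \ell$, with $i_k\le\ell'-1$) having the vertex $x_{i_s}$ in position $i_s$ for each $1\le s\le k$. $K'_\ell(a,b)\subset K_\ell(a,b)$ is the subcomplex of those simplices $\{(x_{i_1},i_1),\dots,(x_{i_k},i_k)\}$, $i_1<\dots<i_k$,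 with $\mathrm{L}(a,x_{i_1},\dots,x_{i_k},b)\le\ell-1$. For a simplicial complex $S$ with a fixed total order on its vertices, $C_n(S)$ is the free $\mathbb{Z}$-module on simplices with $n+1$ elements ($n\ge 0$), with $\partial\{s_0<\dots<s_n\}=\sum_{i=0}^n(-1)^i\{s_0,\dots,\hat{s}_i,\dots,s_n\}$ for $n\ge1$ and $\partial=0$ on $C_0(S)$. For a subcomplex $S'$, $C_\ast(S,S')=C_\ast(S)/C_\ast(S')$, and $H_\ast(S,S')$ is its homology (integer coefficients). *)

(* Defs.v *)
From HB Require Import structures.
From mathcomp Require Import all_boot all_order all_algebra finmap.
From mathcomp Require Import boolp zify.
From mathcomp.multinomials Require Import freeg.

Set Implicit Arguments.
Unset Strict Implicit.
Unset Printing Implicit Defensive.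

Import GRing.Theory.
Local Open Scope fset_scope.
Local Open Scope ring_scope.

(* Chain complexes are graded by nat: the degrees below 0 are zero, so the    *)
(* boundary leaving degree 0 is the zero map and every 0-chain is a cycle.    *)
(* Z-modules are zmodTypes.                                                   *)
Record chain_complex := ChainComplex {
  chain :> nat -> zmodType;
  bd : forall n, {additive chain n.+1 -> chain n};
  bd_bd : forall n x, bd n (bd n.+1 x) = 0 }.

Definition zmod_iso (M N : zmodType) : Prop :=
  exists f : {additive M -> N}, bijective f.

Definition chain_iso (A B : chain_complex) : Prop :=
  exists f : forall n, {additive A n -> B n},
    (forall n, bijective (f n)) /\
    (forall n x, f n (bd A n x) = bd B n (f n.+1 x)).

Section Homology.
Variables (A : chain_complex) (n : nat).

Definition is_cycle : A n -> bool :=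
  match n return A n -> bool with
  | 0 => fun _ => true
  | m.+1 => fun x => bd A m x == 0
  end.

Fact is_cycle_closed : zmod_closed is_cycle.
Proof.
rewrite /is_cycle; case: n => [|m]; split=> //.
  by rewrite unfold_in raddf0.
move=> x y; rewrite !unfold_in raddfB => /eqP -> /eqP ->.
by rewrite subrr.
Qed.
HB.instance Definition _ := GRing.isZmodClosed.Build (A n) is_cycle
  is_cycle_closed.

Definition cycles := {x : A n | is_cycle x}.
HB.instance Definition _ := SubChoice.on cycles.
HB.instance Definition _ := [SubChoice_isSubZmodule of cycles by <:].

Definition is_boundary (z : cycles) : bool := `[< exists y, val z = bd A n y >].

Fact is_boundary_closed : zmod_closed is_boundary.
Proof.
split=> [|x y]; rewrite !unfold_in.
  by apply/asboolP; exists 0; rewrite !raddf0.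
move=> /asboolP[x' ex] /asboolP[y' ey]; apply/asboolP; exists (x' - y').
have -> : val (x - y) = val x - val y by exact: raddfB.
by rewrite raddfB ex ey.
Qed.
HB.instance Definition _ := GRing.isZmodClosed.Build cycles is_boundary
  is_boundary_closed.

Definition homology : zmodType :=
  Quotient.quot (GRing.ZmodClosed.clone cycles is_boundary _).
End Homology.

Record chain_map (A B : chain_complex) := ChainMap {
  cmap :> forall n, {additive A n -> B n};
  cmap_bd : forall n x, cmap n (bd A n x) = bd B n (cmap n.+1 x) }.

(* The cokernel of a chain map; for the inclusion of a subcomplex this is the *)
(* quotient complex.                                                          *)
Section Cokernel.
Variables (A B : chain_complex) (f : chain_map A B).

Definition in_image n (x : B n) : bool := `[< exists y, x = f n y >].

Fact in_image_closed n : zmod_closed (@in_image n).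
Proof.
split=> [|x y]; rewrite !unfold_in.
  by apply/asboolP; exists 0; rewrite raddf0.
move=> /asboolP[x' ->] /asboolP[y' ->]; apply/asboolP; exists (x' - y').
by rewrite raddfB.
Qed.
HB.instance Definition _ n := GRing.isZmodClosed.Build (B n) (@in_image n)
  (@in_image_closed n).

Definition coker n : zmodType :=
  Quotient.quot (GRing.ZmodClosed.clone (B n) (@in_image n) _).

Definition coker_pi n (x : B n) : coker n := (\pi_(coker n) x)%qT.

Definition coker_bd n (z : coker n.+1) : coker n := coker_pi (bd B n (repr z)).

Fact coker_pi_eq n (x y : B n) : in_image (x - y) -> coker_pi x = coker_pi y.
Proof.
move=> xy; apply/eqP; rewrite /coker_pi -Quotient.idealrBE.
exact: xy.
Qed.

Fact coker_bd_pi n (x : B n.+1) : coker_bd (coker_pi x) = coker_pi (bd B n x).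
Proof.
apply: coker_pi_eq; rewrite -raddfB.
have : (repr (coker_pi x) - x) \in @in_image n.+1.
  by rewrite Quotient.idealrBE /coker_pi; rewrite reprK.
rewrite unfold_in => /asboolP[y ->]; apply/asboolP.
by exists (bd A n y); rewrite cmap_bd.
Qed.

Fact coker_pi_sub n (x y : B n) : coker_pi (x - y) = coker_pi x - coker_pi y.
Proof. exact: raddfB. Qed.

Fact coker_repr n (z : coker n) : coker_pi (repr z) = z.
Proof. exact: reprK. Qed.

Fact coker_bd_additive n : zmod_morphism (@coker_bd n).
Proof.
move=> x y; rewrite -[x]coker_repr -[y]coker_repr -coker_pi_sub !coker_bd_pi.
by rewrite raddfB coker_pi_sub.
Qed.
HB.instance Definition _ n := GRing.isZmodMorphism.Build (coker n.+1) (coker n)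
  (@coker_bd n) (@coker_bd_additive n).

Fact coker_bd_bd n (x : coker n.+2) : coker_bd (coker_bd x) = 0.
Proof.
rewrite -[x]coker_repr !coker_bd_pi bd_bd.
exact: raddf0.
Qed.

Definition coker_complex : chain_complex := @ChainComplex coker _ coker_bd_bd.
End Cokernel.

(* The boundary leaving degree 0 of the shifted complex is again the zero map *)
(* by the convention on chain_complex.                                        *)
Definition shift2 (A : chain_complex) : chain_complex :=
  @ChainComplex (fun n => A n.+2) (fun n => bd A n.+2)
    (fun n => bd_bd (c := A) (n := n.+2)).

Section FreeModule.
Variables (T : choiceType) (M : lmodType int).

Definition flift (f : T -> M) : {freeg T / int} -> M := fglift f.

Fact flift_additive f : zmod_morphism (flift f).
Proof. exact: lift_is_additive. Qed.
HB.instance Definition _ f := GRing.isZmodMorphism.Build {freeg T / int} M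
  (flift f) (flift_additive f).

Fact fliftU f x : flift f << x >> = f x.
Proof. by rewrite /flift liftU scale1r. Qed.

End FreeModule.

(* The basis element x of the free Z-module on {x | P x}, and 0 if x does not *)
(* satisfy P.                                                                 *)
Definition fgen (T : choiceType) (P : pred T) (x : T) : {freeg {x | P x} / int} :=
  if insub x is Some y then << y >> else 0.

Fact flift_fgen (T : choiceType) (P : pred T) (M : lmodType int)
    (f : {x | P x} -> M) (g : T -> M) (x : T) :
  (forall y, f y = g (val y)) ->
  flift f (fgen P x) = if P x then g x else 0.
Proof.
move=> fg; rewrite /fgen; case: insubP => [y Px yx|/negbTE ->].
  by rewrite fliftU fg yx Px.
exact: raddf0.
Qed.

Fact fgen_val (T : choiceType) (P : pred T) (y : {x | P x}) : fgen P (val y) = << y >>.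
Proof. by rewrite /fgen valK. Qed.

Fact fgenN (T : choiceType) (P : pred T) (x : T) : ~~ P x -> fgen P x = 0.
Proof. by move=> Px; rewrite /fgen insubN. Qed.

Fact freeg_additive_ext (T : choiceType) (M : zmodType)
    (f g : {additive {freeg T / int} -> M}) :
  (forall x, f << x >> = g << x >>) -> f =1 g.
Proof.
move=> fg; elim/freeg_ind_dom0 => [|k x D _ _ IH]; first by rewrite !raddf0.
rewrite !raddfD IH -[k]intz -freegU_mulz !raddfMz.
by rewrite fg.
Qed.

(* delete i s is s with its i-th entry removed. *)
Definition delete (T : Type) (i : nat) (s : seq T) : seq T :=
  take i s ++ drop i.+1 s.

Fact size_delete (T : Type) i (s : seq T) :
  (i < size s)%N -> size (delete i s) = (size s).-1.
Proof. by move=> h; rewrite /delete size_cat size_take size_drop h; lia. Qed.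

Fact delete_subseq (T : eqType) i (s : seq T) : subseq (delete i s) s.
Proof.
rewrite /delete -{3}[s](cat_take_drop i) cat_subseq //.
rewrite -add1n -drop_drop; exact: drop_subseq.
Qed.

Fact delete_delete (T : Type) (i j : nat) (s : seq T) :
  (i <= j)%N -> delete j (delete i s) = delete i (delete j.+1 s).
Proof.
elim: s i j => [|x s IH] [|i] [|j] //= h; rewrite /delete /= ?drop0 //.
by congr (_ :: _); exact: IH.
Qed.

Fact alternating_sum0 (M : lmodType int) (n : nat) (g : nat -> nat -> M) :
  (forall i j, (i <= j)%N -> g i j = g j.+1 i) ->
  \sum_(i < n.+1) \sum_(j < n) (-1) ^+ (i + j) *: g i j = 0.
Proof.
move=> gE; pose F i j : M := (-1) ^+ (i + j) *: g i j.
have FE i j : (i <= j)%N -> F j.+1 i = - F i j.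
  by move=> ij; rewrite /F -(gE _ _ ij) addSn exprS addnC mulN1r scaleNr.
under eq_bigr => i _ do rewrite (bigID (fun j : 'I_n => (i <= j)%N)) /=.
rewrite big_split /= big_ord_recr /=.
rewrite [X in _ + X + _]big1 ?addr0; last first.
  by move=> j; rewrite leqNgt ltn_ord.
rewrite [X in _ + X]big_ord_recl /= [X in _ + (X + _)]big1 // add0r.
rewrite (exchange_big_dep predT) //= -big_split big1 //= => i _.
rewrite [X in _ + X](eq_bigl (fun j : 'I_n => (j <= i)%N)) => [|j]; last first.
  by rewrite /bump leq0n add1n -ltnNge ltnS.
rewrite -big_split big1 //= => j ij.
by rewrite -!/(F _ _) /bump leq0n add1n FE // subrr.
Qed.

Record simplicial_complex (T : choiceType) := SimplicialComplex {
  simplex :> pred {fset T};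
  simplex_neq0 : forall s, simplex s -> s != fset0;
  simplex_face : forall s t, simplex s -> t `<=` s -> t != fset0 -> simplex t }.

Record simplicial_pair (T : choiceType) := SimplicialPair {
  total_complex : simplicial_complex T;
  subcomplex : simplicial_complex T;
  subcomplex_sub : forall s, subcomplex s -> total_complex s }.

Record total_order (T : choiceType) := TotalOrder {
  ord_le :> rel T;
  ord_anti : antisymmetric ord_le;
  ord_trans : transitive ord_le;
  ord_total : total ord_le }.

Section SimplicialChains.
Variables (T : choiceType) (r : total_order T).
Implicit Types (S : simplicial_complex T) (s : {fset T}).

Definition is_nsimplex S n : pred {fset T} :=
  fun s => simplex S s && (#|` s| == n.+1).

Definition nsimplex S n := {s : {fset T} | is_nsimplex S n s}.

Definition simplex_bd S n s : {freeg (nsimplex S n) / int} :=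
  \sum_(i < n.+2) (-1) ^+ i *:
    fgen (is_nsimplex S n) [fset x in delete i (sort r s)].

Definition schain_bd S n :
    {freeg (nsimplex S n.+1) / int} -> {freeg (nsimplex S n) / int} :=
  flift (fun s : nsimplex S n.+1 => simplex_bd S n (val s)).

HB.instance Definition _ S n := GRing.isZmodMorphism.Build
  {freeg (nsimplex S n.+1) / int} {freeg (nsimplex S n) / int}
  (@schain_bd S n) (flift_additive _).

Fact schain_bd_fgen S n s : schain_bd (fgen (is_nsimplex S n.+1) s) =
  if is_nsimplex S n.+1 s then simplex_bd S n s else 0.
Proof. exact: flift_fgen. Qed.

Fact schain_bdU S n (s : nsimplex S n.+1) :
  schain_bd << s >> = simplex_bd S n (val s).
Proof. exact: fliftU. Qed.

Fact sort_delete s i :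
  sort r [fset x in delete i (sort r s)] = delete i (sort r s).
Proof.
have srt : sorted r (sort r s) := sort_sorted (@ord_total _ r) _.
apply: (sorted_eq (@ord_trans _ r) (@ord_anti _ r)).
- exact: sort_sorted (@ord_total _ r) _.
- exact: subseq_sorted (@ord_trans _ r) _ _ (delete_subseq _ _) srt.
rewrite perm_sort; apply: uniq_perm; first exact: fset_uniq.
  by apply: subseq_uniq (delete_subseq _ _) _; rewrite sort_uniq fset_uniq.
by move=> x; rewrite in_fset.
Qed.

(* All the faces occurring in simplex_bd are genuine simplices, so fgen never *)
(* takes its default value 0 there.                                           *)
Fact face_nsimplex S n s i : is_nsimplex S n.+1 s -> (i < n.+2)%N ->
  is_nsimplex S n [fset x in delete i (sort r s)].
Proof.
move=> /andP[Ss /eqP cs] i_lt.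
have card_face : #|` [fset x in delete i (sort r s)]| = n.+1.
  rewrite -[LHS](size_sort r) sort_delete size_delete size_sort ?cs //.
rewrite /is_nsimplex card_face eqxx andbT; apply: (simplex_face Ss).
  apply/fsubsetP => x; rewrite in_fset => /(mem_subseq (delete_subseq _ _)).
  by rewrite mem_sort.
by rewrite -cardfs_gt0 card_face.
Qed.

Fact schain_bd_bd S n (x : {freeg (nsimplex S n.+2) / int}) :
  schain_bd (schain_bd x) = 0.
Proof.
pose h : {additive {freeg (nsimplex S n.+2) / int} ->
  {freeg (nsimplex S n) / int}} := @schain_bd S n \o @schain_bd S n.+1.
pose z : {additive {freeg (nsimplex S n.+2) / int} ->
  {freeg (nsimplex S n) / int}} := \0.
apply: (@freeg_additive_ext _ _ h z) => {x} s; rewrite /h /z /=.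
rewrite schain_bdU /simplex_bd raddf_sum /=.
set t := sort r (val s).
rewrite -[RHS](@alternating_sum0 _ n.+2
  (fun i j => fgen (is_nsimplex S n) [fset x in delete j (delete i t)])).
  apply: eq_bigr => i _; rewrite raddfZsign /= schain_bd_fgen.
  rewrite face_nsimplex ?(valP s) // /simplex_bd scaler_sumr.
  by apply: eq_bigr => j _; rewrite sort_delete scalerA exprD.
by move=> i j ij; rewrite delete_delete.
Qed.

Definition schain S : chain_complex :=
  @ChainComplex (fun n => {freeg (nsimplex S n) / int}) (@schain_bd S)
    (@schain_bd_bd S).

(* Augmented chain complex, with its degree shifted up by one: degree 0 is Z  *)
(* and degree n.+1 is C_n(S).                                                 *)
Definition aug_chain S (n : nat) : zmodType :=
  if n is m.+1 then schain S m else int.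

Definition aug_bd S n : {additive aug_chain S n.+1 -> aug_chain S n} :=
  match n return {additive aug_chain S n.+1 -> aug_chain S n} with
  | 0 => @deg (nsimplex S 0)
  | m.+1 => bd (schain S) m
  end.

Fact aug_bd_bd S n x : aug_bd S n (aug_bd S n.+1 x) = 0.
Proof.
case: n x => [|n] x; last exact: schain_bd_bd.
pose h : {additive {freeg (nsimplex S 1) / int} -> int} :=
  @deg (nsimplex S 0) \o @schain_bd S 0.
pose z : {additive {freeg (nsimplex S 1) / int} -> int} := \0.
apply: (@freeg_additive_ext _ _ h z) => {x} s; rewrite /h /z /=.
rewrite schain_bdU /simplex_bd raddf_sum /=.
have degE i : (i < 2)%N ->
    deg (fgen (is_nsimplex S 0) [fset x in delete i (sort r (val s))]) = 1.
  move=> i2; have fs := face_nsimplex (valP s) i2.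
  by rewrite /fgen insubT degU.
by rewrite !big_ord_recl big_ord0 /= expr0 expr1 scale1r scaleN1r degN !degE //.
Qed.

Definition augmented S : chain_complex := ChainComplex (@aug_bd_bd S).

Definition reduced_homology S n : zmodType := homology (augmented S) n.+1.

Section Relative.
Variable P : simplicial_pair T.
Local Notation K := (total_complex P).
Local Notation K' := (subcomplex P).

Definition schain_incl n :
    {freeg (nsimplex K' n) / int} -> {freeg (nsimplex K n) / int} :=
  flift (fun s : nsimplex K' n => fgen (is_nsimplex K n) (val s)).

HB.instance Definition _ n := GRing.isZmodMorphism.Build
  {freeg (nsimplex K' n) / int} {freeg (nsimplex K n) / int}
  (@schain_incl n) (flift_additive _).

Fact schain_incl_fgen n s : schain_incl (fgen (is_nsimplex K' n) s) =
  if is_nsimplex K' n s then fgen (is_nsimplex K n) s else 0.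
Proof. exact: flift_fgen. Qed.

Fact schain_inclU n (s : nsimplex K' n) :
  schain_incl << s >> = fgen (is_nsimplex K n) (val s).
Proof. exact: fliftU. Qed.

Fact is_nsimplex_sub n s : is_nsimplex K' n s -> is_nsimplex K n s.
Proof. by move=> /andP[/subcomplex_sub Ks cs]; rewrite /is_nsimplex Ks. Qed.

Fact schain_incl_bd n (x : schain K' n.+1) :
  schain_incl (bd (schain K') n x) = bd (schain K) n (schain_incl x).
Proof.
pose f : {additive {freeg (nsimplex K' n.+1) / int} ->
  {freeg (nsimplex K n) / int}} := @schain_incl n \o @schain_bd K' n.
pose g : {additive {freeg (nsimplex K' n.+1) / int} ->
  {freeg (nsimplex K n) / int}} := @schain_bd K n \o @schain_incl n.+1.
apply: (@freeg_additive_ext _ _ f g) => {x} s; rewrite /f /g /=.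
rewrite schain_bdU schain_inclU schain_bd_fgen is_nsimplex_sub ?(valP s) //.
rewrite /simplex_bd raddf_sum; apply: eq_bigr => i _.
rewrite raddfZsign /= schain_incl_fgen.
by rewrite face_nsimplex // (valP s).
Qed.

Definition relative_schain : chain_complex :=
  coker_complex (@ChainMap (schain K') (schain K) schain_incl schain_incl_bd).
End Relative.

End SimplicialChains.

(* Vertices may form an infinite set; adj x y means that {x, y} is an edge.   *)
Record graph := Graph {
  vertex :> choiceType;
  adj : rel vertex;
  adj_sym : symmetric adj;
  adj_irr : irreflexive adj }.

Definition walk (G : graph) (n : nat) (x y : G) : Prop :=
  exists p : seq G, [/\ path (@adj G) x p, last x p = y & size p = n].

Definition connected (G : graph) : Prop :=
  forall x y : G, exists n, walk n x y.

Record connected_graph := ConnectedGraph {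
  cgraph :> graph;
  cgraphP : connected cgraph }.

Section MagnitudeChains.
Variable G : connected_graph.
Implicit Types (x y z a b : G) (s p : seq G) (i j k l n : nat).

Fact dist_subproof x y : exists n, `[< walk n x y >].
Proof. by have [n w] := cgraphP x y; exists n; apply/asboolP. Qed.

Definition dist x y : nat := ex_minn (dist_subproof x y).

Fact dist_walk x y : walk (dist x y) x y.
Proof. by rewrite /dist; case: ex_minnP => n /asboolP. Qed.

Fact dist_le n x y : walk n x y -> (dist x y <= n)%N.
Proof. by move=> w; rewrite /dist; case: ex_minnP => m _; apply; apply/asboolP. Qed.

Fact dist_triangle x y z : (dist x z <= dist x y + dist y z)%N.
Proof.
have [p [pp lp <-]] := dist_walk x y; have [q [pq lq <-]] := dist_walk y z.
apply: dist_le; exists (p ++ q).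
by rewrite cat_path last_cat size_cat lp pp pq lq.
Qed.

Fact dist_gt0 x y : x != y -> (0 < dist x y)%N.
Proof.
rewrite lt0n; apply: contraNneq => d0; have [p [_ lp sp]] := dist_walk x y.
by rewrite d0 in sp; rewrite (size0nil sp) in lp; rewrite -lp.
Qed.

Fact dist_xx x : dist x x = 0%N.
Proof. by apply/eqP; rewrite -leqn0; apply: dist_le; exists [::]. Qed.

(* L(s), the sum of the distances between consecutive entries of s. *)
Definition len s : nat := if s is x :: s' then sumn (pairmap dist x s') else 0.

Fact len_cat s x s' : len (s ++ x :: s') = (len (rcons s x) + len (x :: s'))%N.
Proof.
case: s => [|y s] //=; elim: s y => [|z s IH] y /=; first by rewrite addn0.
by rewrite IH addnA.
Qed.

Fact len_subseq a b s s' : subseq s s' ->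
  (len (a :: rcons s b) <= len (a :: rcons s' b))%N.
Proof.
elim: s' s a => [|y s' IH] s a; first by rewrite subseq0 => /eqP ->.
case: s => [_|x s]; last first.
  rewrite [subseq _ _]/=; case: eqP => [->|_] h.
    by rewrite /= leq_add2l; apply: IH.
  have := IH _ y h; rewrite /= => h'.
  by have := dist_triangle a y x; lia.
have := IH _ y (sub0seq s'); rewrite /= !addn0 => h'.
by have := dist_triangle a y b; lia.
Qed.

Fact delete_split i s : (0 < i)%N -> (i.+1 < size s)%N ->
  exists s1 u v w s2, s = s1 ++ u :: v :: w :: s2 /\ i = (size s1).+1.
Proof.
case: i => // i _; elim: i s => [|i IH] [|u [|v [|w s]]] //= h.
  by exists [::], u, v, w, s.
have [|s1 [u' [v' [w' [s2 [e ->]]]]]] := IH (v :: w :: s); first exact: h.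
by exists (u :: s1), u', v', w', s2; rewrite e.
Qed.

(* The generators of MC_{k,l}(a,b). *)
Definition is_mctuple l a b k : pred (seq G) := fun s =>
  [&& size s == k.+1, head a s == a, last b s == b,
      sorted (fun x y => x != y) s & len s == l].

Definition mctuple l a b k := {s : seq G | is_mctuple l a b k s}.

(* Under the condition tested by mcface the tuple delete i s is a generator,  *)
(* so fgen does not take its default value 0 (see mctuple_delete).            *)
Definition mcface l a b k i s : {freeg (mctuple l a b k) / int} :=
  if dist (nth a s i.-1) (nth a s i.+1) ==
     (dist (nth a s i.-1) (nth a s i) + dist (nth a s i) (nth a s i.+1))%N
  then fgen (is_mctuple l a b k) (delete i s) else 0.

Definition mctuple_bd l a b k s : {freeg (mctuple l a b k) / int} :=
  \sum_(1 <= i < k.+1) (-1) ^+ i *: mcface l a b k i s.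

Definition mc_bd l a b k :
    {freeg (mctuple l a b k.+1) / int} -> {freeg (mctuple l a b k) / int} :=
  flift (fun s : mctuple l a b k.+1 => mctuple_bd l a b k (val s)).

HB.instance Definition _ l a b k := GRing.isZmodMorphism.Build
  {freeg (mctuple l a b k.+1) / int} {freeg (mctuple l a b k) / int}
  (@mc_bd l a b k) (flift_additive _).

Fact delete_cat3 s1 u v w s2 :
  delete (size s1).+1 (s1 ++ u :: v :: w :: s2) = s1 ++ u :: w :: s2.
Proof.
by elim: s1 => [|x s1 IH] //=; rewrite /delete /= ?take0 ?drop0 //; congr (_ :: _).
Qed.

Fact mctuple_delete l a b k i s :
  is_mctuple l a b k.+1 s -> (0 < i < k.+1)%N ->
  let d_eq := dist (nth a s i.-1) (nth a s i.+1) ==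
     (dist (nth a s i.-1) (nth a s i) + dist (nth a s i) (nth a s i.+1))%N in
  is_mctuple l a b k (delete i s) = d_eq /\ (len (delete i s) == l) = d_eq.
Proof.
move=> /and5P[/eqP sz hd lst neq /eqP ln] /andP[i_gt0 i_lt].
have [|s1 [u [v [w [s2 [es ei]]]]]] := delete_split (s := s) i_gt0.
  by rewrite sz ltnS.
rewrite es in sz hd lst neq ln *; rewrite {i}ei in i_gt0 i_lt *.
rewrite delete_cat3 /=.
have nthE j : nth a (s1 ++ u :: v :: w :: s2) (size s1 + j) =
  nth a (u :: v :: w :: s2) j by rewrite nth_cat ltnNge leq_addr /= addKn.
have := nthE 0; rewrite addn0 => ->.
have := nthE 1; rewrite addn1 => ->; have := nthE 2; rewrite addn2 => -> /=.
rewrite /is_mctuple; move: sz hd lst neq ln.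
rewrite !size_cat /= => sz hd lst neq ln.
have -> : (size s1 + (size s2).+2)%N == k.+1 by apply/eqP; lia.
have -> : head a (s1 ++ u :: w :: s2) == a by case: (s1) hd.
have -> : last b (s1 ++ u :: w :: s2) == b by move: lst; rewrite !last_cat.
move: neq; rewrite !sorted_cat_cons /= => /and4P[neq1 uv vw neq2].
rewrite neq1 neq2 andbT /=.
have uv_gt0 := dist_gt0 uv; have vw_gt0 := dist_gt0 vw.
rewrite len_cat /= in ln *; rewrite len_cat /= -ln eqn_add2l addnA eqn_add2r.
split=> //; case: (eqVneq u w) => [<-|] //=.
by rewrite dist_xx; apply/esym/negbTE; lia.
Qed.

Fact mcfaceE l a b k i s : is_mctuple l a b k.+1 s -> (0 < i < k.+1)%N ->
  mcface l a b k i s = fgen (is_mctuple l a b k) (delete i s).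
Proof.
move=> s_mc i_range; rewrite /mcface -(mctuple_delete s_mc i_range).1.
by case: ifP => // /negbT /fgenN ->.
Qed.

Fact len_delete i s : (0 < i)%N -> (i.+1 < size s)%N ->
  (len (delete i s) <= len s)%N.
Proof.
move=> i_gt0 i_lt; have [s1 [u [v [w [s2 [-> ->]]]]]] := delete_split i_gt0 i_lt.
rewrite delete_cat3 !len_cat /= leq_add2l addnA leq_add2r.
exact: dist_triangle.
Qed.

Fact mc_bd_fgen l a b k s : mc_bd (fgen (is_mctuple l a b k.+1) s) =
  if is_mctuple l a b k.+1 s then mctuple_bd l a b k s else 0.
Proof. exact: flift_fgen. Qed.

Fact mc_bdU l a b k (s : mctuple l a b k.+1) :
  mc_bd << s >> = mctuple_bd l a b k (val s).
Proof. exact: fliftU. Qed.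

Fact mc_bd_bd l a b k (x : {freeg (mctuple l a b k.+2) / int}) :
  mc_bd (mc_bd x) = 0.
Proof.
pose h : {additive {freeg (mctuple l a b k.+2) / int} ->
  {freeg (mctuple l a b k) / int}} := @mc_bd l a b k \o @mc_bd l a b k.+1.
pose z : {additive {freeg (mctuple l a b k.+2) / int} ->
  {freeg (mctuple l a b k) / int}} := \0.
apply: (@freeg_additive_ext _ _ h z) => {x} [[s s_mc]]; rewrite /h /z /=.
rewrite mc_bdU /mctuple_bd raddf_sum big_add1 big_mkord /=.
rewrite -[RHS](@alternating_sum0 _ k
  (fun i j => fgen (is_mctuple l a b k) (delete j.+1 (delete i.+1 s)))); last first.
  by move=> i j ij; rewrite delete_delete.
have sz : size s = k.+3 by case/and5P: s_mc => /eqP.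
apply: eq_bigr => i _; have i_lt := ltn_ord i.
rewrite raddfZsign /= mcfaceE // mc_bd_fgen.
have szi : size (delete i.+1 s) = k.+2 by rewrite size_delete sz //; lia.
case: ifPn => [si_mc|si_mc].
  rewrite /mctuple_bd big_add1 big_mkord scaler_sumr; apply: eq_bigr => j _.
  have j_lt := ltn_ord j; rewrite mcfaceE //.
  by rewrite scalerA -exprD addSn addnS !exprS !mulN1r opprK.
rewrite scaler0 big1 // => j _; have j_lt := ltn_ord j; rewrite fgenN ?scaler0 //.
apply: contra si_mc => /and5P[_ _ _ _ /eqP sij_len].
have [|-> <-] := mctuple_delete s_mc (i := i.+1); first by lia.
have/and5P[_ _ _ _ /eqP s_len] := s_mc.
rewrite eqn_leq -{1}s_len -sij_len.
by rewrite !len_delete ?sz ?szi //; lia.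
Qed.

Definition MC l a b : chain_complex :=
  @ChainComplex (fun k => {freeg (mctuple l a b k) / int}) (@mc_bd l a b)
    (@mc_bd_bd l a b).

Definition MH k l a b : zmodType := homology (MC l a b) k.

(* p, of length (size p).-1, is an element of P_{<=l}(a,b). *)
Definition is_path_le l a b p : bool :=
  [&& (2 <= size p <= l.+1)%N, head a p == a, last b p == b &
      sorted (fun x y => dist x y == 1%N) p].

Implicit Types sigma : {fset G * nat}.

(* A vertex (x, i) of K_l(a,b) is the pair of a vertex x of G and a position  *)
(* i in {1, ..., l - 1}; in a path p of length l' = (size p).-1, the bound    *)
(* i <= l' - 1 reads i.+1 < size p. Since all the members of sigma lie on p,  *)
(* their positions are pairwise distinct.                                     *)
Definition K_simplex l a b sigma : Prop :=
  [/\ sigma != fset0,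
      {in sigma, forall v, (1 <= v.2 <= l.-1)%N} &
      exists2 p, is_path_le l a b p &
        {in sigma, forall v, (v.2.+1 < size p)%N /\ nth a p v.2 = v.1}].

(* x_{i_1}, ..., x_{i_k} for sigma = {(x_{i_1}, i_1), ..., (x_{i_k}, i_k)}    *)
(* with i_1 < ... < i_k.                                                      *)
Definition positional sigma : seq G :=
  [seq v.1 | v <- sort (fun u v => (u.2 <= v.2)%N) sigma].

Definition K'_simplex l a b sigma : Prop :=
  K_simplex l a b sigma /\
  (len (a :: rcons (positional sigma) b) <= l.-1)%N.

Fact K_simplex_neq0 l a b sigma : `[< K_simplex l a b sigma >] -> sigma != fset0.
Proof. by move=> /asboolP[]. Qed.

Fact K_simplex_sub l a b sigma tau : K_simplex l a b sigma ->
  tau `<=` sigma -> tau != fset0 -> K_simplex l a b tau.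
Proof.
move=> [_ s_rng [p p_path s_p]] /fsubsetP ts t0; split=> //.
  by move=> v /ts; apply: s_rng.
by exists p => // v /ts; apply: s_p.
Qed.

Fact K_simplex_face l a b sigma tau : `[< K_simplex l a b sigma >] ->
  tau `<=` sigma -> tau != fset0 -> `[< K_simplex l a b tau >].
Proof. by move=> /asboolP Ks ts t0; apply/asboolP; exact: K_simplex_sub Ks ts t0. Qed.

Definition K_complex l a b : simplicial_complex (G * nat)%type :=
  @SimplicialComplex _ (fun sigma => `[< K_simplex l a b sigma >])
    (@K_simplex_neq0 l a b) (@K_simplex_face l a b).

Fact positional_subseq l a b sigma tau : K_simplex l a b sigma ->
  tau `<=` sigma -> subseq (positional tau) (positional sigma).
Proof.
move=> [_ _ [p _ s_p]] /fsubsetP ts; apply: map_subseq.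
set leT := fun u v : G * nat => (u.2 <= v.2)%N.
have leT_tr : transitive leT by move=> u v w; apply: leq_trans.
have leT_tot : total leT by move=> u v; apply: leq_total.
have -> : sort leT tau = sort leT [seq v <- sigma | v \in tau].
  apply/perm_sort_inP.
  - by move=> u v _ _; apply: leT_tot.
  - by move=> u v w _ _ _; apply: leT_tr.
  - move=> u v /ts /s_p[_ eu] /ts /s_p[_ ev] uv.
    have e2 : u.2 = v.2 by apply/eqP; rewrite eqn_leq.
    by move: eu ev e2; case: u {uv} => u1 u2; case: v => v1 v2 /= <- <- ->.
  apply: uniq_perm; rewrite ?filter_uniq ?fset_uniq // => v.
  by rewrite mem_filter; case: (boolP (v \in tau)) => [/ts ->|].
by apply: subseq_sort; rewrite // filter_subseq.
Qed.

Fact K'_simplex_neq0 l a b sigma : `[< K'_simplex l a b sigma >] -> sigma != fset0.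
Proof. by move=> /asboolP[[]]. Qed.

Fact K'_simplex_face l a b sigma tau : `[< K'_simplex l a b sigma >] ->
  tau `<=` sigma -> tau != fset0 -> `[< K'_simplex l a b tau >].
Proof.
move=> /asboolP[Ks ls] ts t0; apply/asboolP; split.
  exact: K_simplex_sub Ks ts t0.
by apply: leq_trans ls; apply: len_subseq; apply: positional_subseq Ks ts.
Qed.

Definition K'_complex l a b : simplicial_complex (G * nat)%type :=
  @SimplicialComplex _ (fun sigma => `[< K'_simplex l a b sigma >])
    (@K'_simplex_neq0 l a b) (@K'_simplex_face l a b).

Fact K'_complex_sub l a b sigma : K'_complex l a b sigma -> K_complex l a b sigma.
Proof. by move=> /asboolP[Ks _]; apply/asboolP. Qed.

Definition K_pair l a b : simplicial_pair (G * nat)%type :=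
  SimplicialPair (@K'_complex_sub l a b).

End MagnitudeChains.

(* Main.v *)
(* If L(a, x_{i_1}, ..., x_{i_k}, b) = l for a simplex of K_l(a,b), then any  *)
(* path through it has length exactly l and is geodesic between consecutive   *)
(* marked vertices, so the position of each x_{i_s} is the length of the      *)
(* prefix of the tuple ending at it. Hence the simplices outside K'_l(a,b)    *)
(* correspond bijectively to the generators of MC_{*,l}(a,b), and deleting a  *)
(* vertex of the simplex corresponds to deleting an interior entry of the     *)
(* tuple. As the vertices are ordered by an arbitrary total order r and not   *)
(* by position, the isomorphism carries the sign of the permutation relating  *)
(* the two orders, together with (-1)^n for the shift of the summation index. *)
(* In degree 2, MC_1 vanishes if d(a,b) < l; if d(a,b) = l then K'_l(a,b) is  *)
(* empty and MC_2 -> MC_1 = Z is minus the augmentation.                      *)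

From HB Require Import structures.
Require Import Defs.
From mathcomp Require Import all_boot all_order all_algebra finmap.
From mathcomp Require Import boolp zify.
From mathcomp.multinomials Require Import freeg.

Set Implicit Arguments.
Unset Strict Implicit.
Unset Printing Implicit Defensive.

Import GRing.Theory.

(** Paths have unit steps, so two vertices marked on a path are at distance at most the gap between
    their positions; a path shorter than [l] can be imagined to wait at [b] until time [l]
    ([K_short]). Summed over consecutive marked vertices, with [(a, 0)] and [(b, l)] at the ends,
    these bounds telescope to L <= l, and equality in the sum forces equality in each of them, which
    recovers the positions from the tuple ([short_len], [short_place]). So K' consists of the
    simplices of K with L < l, and the others match the generators of MC; the inverse construction
    concatenates geodesics ([simplex_ofK], [endpoint_tupleK]).

    A face of a simplex outside K' falls into K' exactly when the corresponding deletion shortens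
    the tuple, that is, when the magnitude differential makes it 0 ([nsimplex_mctuple], [mcfaceE]).
    With the sign rule [pos_inv_fsetD1], the map [simplex_tuple] therefore commutes with boundaries;
    it kills C(K') and is invertible modulo C(K'), whence [relative_schain_iso]. Homology then
    follows from [homology_iso]; in degree 2 the remaining work is to compare cycles, by
    [mctuple1_eq0] or [mc_bd_simplex_tuple0]. *)

Section HomologyIso.
Local Open Scope ring_scope.

(** * Isomorphisms induced on homology *)

Lemma zmod_iso_sym (M N : zmodType) : zmod_iso M N -> zmod_iso N M.
Proof.
case=> f [g fK gK].
have g_additive : zmod_morphism g.
  by move=> x y; apply: (can_inj fK); rewrite raddfB !gK.
pose gA := GRing.isZmodMorphism.Build N M g g_additive.
by exists (HB.pack_for {additive N -> M} g gA); exists f.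
Qed.

Lemma bijective_inj_surj (T U : Type) (f : T -> U) :
  injective f -> (forall y, exists x, f x = y) -> bijective f.
Proof.
move=> f_inj /choice[g gK]; exists g => // x.
by apply: f_inj; rewrite gK.
Qed.

Definition homology_pi (C : chain_complex) k (x : cycles C k) : homology C k :=
  (\pi_(homology C k) x)%qT.

Lemma homology_reprK (C : chain_complex) k (z : homology C k) :
  homology_pi (repr z) = z.
Proof. exact: reprK. Qed.

Lemma homology_piB (C : chain_complex) k (x y : cycles C k) :
  homology_pi (x - y) = homology_pi x - homology_pi y.
Proof. exact: raddfB. Qed.

Lemma homology_pi_eq (C : chain_complex) k (x y : cycles C k) :
  homology_pi x = homology_pi y <-> exists w, val x - val y = bd C k w.
Proof.
have -> : val x - val y = val (x - y) by rewrite raddfB.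
split=> [/eqP|[w h]].
  by rewrite -Quotient.idealrBE => /asboolP.
by apply/eqP; rewrite -Quotient.idealrBE; apply/asboolP; exists w.
Qed.

Section Induced.
Variables (A B : chain_complex) (n m : nat).
Variables (f : {additive A n -> B m}) (f' : A n.+1 -> B m.+1).
Hypotheses (f_bij : bijective f) (f'_bij : bijective f').
Hypothesis f_bd : forall x, f (bd A n x) = bd B m (f' x).
Hypothesis f_cycle : forall x, is_cycle (f x) = is_cycle x.

Lemma boundary_bij x : (exists y, f x = bd B m y) <-> (exists y, x = bd A n y).
Proof.
split=> [[y fx]|[y ->]]; last by exists (f' y).
have [g fK gK] := f'_bij; exists (g y).
by apply: (bij_inj f_bij); rewrite fx f_bd gK.
Qed.

Definition cycle_map (z : cycles A n) : cycles B m :=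
  Sub (f (val z)) (etrans (f_cycle (val z)) (valP z)).

Definition homology_map (z : homology A n) : homology B m :=
  homology_pi (cycle_map (repr z)).

Lemma homology_map_pi x : homology_map (homology_pi x) = homology_pi (cycle_map x).
Proof.
apply/homology_pi_eq; rewrite /= -raddfB; apply/boundary_bij/homology_pi_eq.
exact: homology_reprK.
Qed.

Lemma homology_map_additive : zmod_morphism homology_map.
Proof.
move=> x y; rewrite -{1}[x]homology_reprK -{1}[y]homology_reprK.
rewrite -homology_piB homology_map_pi /homology_map -homology_piB.
congr homology_pi; by apply: val_inj; rewrite /= !raddfB.
Qed.

HB.instance Definition _ := GRing.isZmodMorphism.Build _ _ homology_map
  homology_map_additive.

(** The degrees [n] and [m] are independent, which absorbs the shift by two. Cycles are compared by
    the hypothesis [f_cycle] rather than by a map one degree lower, because in degree 0 every chain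
    is a cycle while the matching degree of the other complex may carry a genuine boundary. *)
Lemma homology_iso : zmod_iso (homology A n) (homology B m).
Proof.
exists homology_map; apply: bijective_inj_surj => [x y|y].
  rewrite -[x]homology_reprK -[y]homology_reprK /= !homology_map_pi.
  by move=> /homology_pi_eq; rewrite /= -raddfB => /boundary_bij/homology_pi_eq.
have [g fK gK] := f_bij.
have cyc : is_cycle (g (val (repr y))) by rewrite -f_cycle gK (valP (repr y)).
exists (homology_pi (Sub _ cyc : cycles A n)).
rewrite /= homology_map_pi -[RHS]homology_reprK; congr homology_pi.
by apply: val_inj; rewrite /= gK.
Qed.

End Induced.
End HomologyIso.

(** * Inversions between two orders on the same elements *)

Section Inversions.
Variables (T : eqType) (lt1 lt2 : rel T).

Definition inversions (s : seq T) : nat :=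
  \sum_(u <- s) \sum_(v <- s) (lt1 u v && lt2 v u).

Lemma perm_inversions s t : perm_eq s t -> inversions s = inversions t.
Proof.
move=> st; rewrite /inversions (perm_big _ st) /=.
by apply: eq_bigr => u _; apply: perm_big.
Qed.

(* For u <> w write a = [u <1 w] and p = [u <2 w]; {u, w} is inverted iff    *)
(* a <> p, and a + (a && ~~ p) + (~~ a && p) = p + 2 (a && ~~ p).             *)
Lemma inversions_cons w s : irreflexive lt1 ->
  {in s, forall u, lt1 w u = ~~ lt1 u w} ->
  {in s, forall u, lt2 w u = ~~ lt2 u w} ->
  inversions (w :: s) + count (lt1^~ w) s =
  inversions s + count (lt2^~ w) s + (\sum_(u <- s) (lt1 u w && lt2 w u)).*2.
Proof.
move=> irr1 tot1 tot2.
have countE (P : pred T) : count P s = \sum_(u <- s) P u.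
  by rewrite -sum1_count big_mkcond; apply: eq_bigr => u _; case: (P u).
rewrite /inversions big_cons big_cons irr1 /=.
under [X in _ + X + _ = _]eq_bigr => u _ do rewrite big_cons.
rewrite big_split /= !countE add0n.
set I := \sum_(i <- s) \sum_(j <- s) _.
set C := \sum_(j <- s) (lt1 w j && _); set B := \sum_(i <- s) _.
set X := \sum_(i <- s) lt1 i w; set Y := \sum_(i <- s) lt2 i w.
suff : X + B + C = Y + B + B by lia.
rewrite /X /Y /B /C -!big_split /= big_seq [RHS]big_seq.
apply: eq_bigr => u us; rewrite (tot1 _ us) (tot2 _ us).
by case: (lt1 u w); case: (lt2 u w).
Qed.

End Inversions.

(** Turns an index into a count, which does not depend on how the elements are listed; indices in
    two different sortings of one set thereby become comparable. *)
Lemma index_pairwise (T : eqType) (lt : rel T) (s : seq T) v :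
  (forall x y, lt x y -> ~~ lt y x) -> pairwise lt s -> v \in s ->
  index v s = count (lt^~ v) s.
Proof.
move=> asym; elim: s => //= x s IH /andP[lt_x pw].
rewrite inE eq_sym; case: (eqVneq x v) => [<- _|_ /= vs].
  have -> : lt x x = false by apply/negP => h; move/negP: (asym _ _ h).
  rewrite add0n; apply/esym/eqP; rewrite -leqn0 leqNgt -has_count.
  apply/hasPn => y ys; apply: asym; exact: (allP lt_x).
by rewrite (allP lt_x _ vs) IH.
Qed.

(** Reindexes a boundary by the removed entry instead of its rank, so that boundaries written in two
    different orders can be matched term by term. *)
Lemma sum_delete (T : eqType) (V : nmodType) (F : nat -> seq T -> V) (s : seq T) :
  uniq s -> (\sum_(i < size s) F i (delete i s) =
             \sum_(v <- s) F (index v s) (rem v s))%R.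
Proof.
case: s => [|x0 s] us; first by rewrite big_ord0 big_nil.
rewrite (big_nth x0) big_mkord; apply: eq_bigr => i _.
by rewrite remE index_uniq.
Qed.

(** * The simplicial boundary for an arbitrary vertex order *)

Section StrictOrder.
Variables (T : choiceType) (r : total_order T).
Implicit Types (s : {fset T}) (u v : T).

Definition ord_lt : rel T := fun u v => r u v && (u != v).

Lemma ord_lt_irr : irreflexive ord_lt.
Proof. by move=> u; rewrite /ord_lt eqxx andbF. Qed.

Lemma ord_lt_asym u v : ord_lt u v -> ~~ ord_lt v u.
Proof.
move=> /andP[uv neq]; apply: contraNN neq => /andP[vu _].
by apply/eqP; apply: (@ord_anti _ r); rewrite uv.
Qed.

Lemma ord_lt_total u v : u != v -> ord_lt v u = ~~ ord_lt u v.
Proof.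
move=> uv; apply/idP/idP => [/ord_lt_asym //|].
by rewrite /ord_lt uv eq_sym uv !andbT => /negbTE h; have := ord_total r u v; rewrite h.
Qed.

Lemma index_sort_ord s v : v \in s -> index v (sort r s) = count (ord_lt^~ v) s.
Proof.
move=> vs; rewrite (@index_pairwise _ ord_lt) ?mem_sort //.
- by apply/permP; rewrite perm_sort.
- exact: ord_lt_asym.
rewrite pairwise_relI; apply/andP; split; last first.
  by rewrite -uniq_pairwise sort_uniq fset_uniq.
rewrite -sorted_pairwise; last exact: (@ord_trans _ r).
exact: sort_sorted (@ord_total _ r) _.
Qed.

Lemma perm_fsetD1 s v : v \in s -> perm_eq s (v :: (s `\ v)%fset).
Proof.
move=> vs; apply: uniq_perm; rewrite ?fset_uniq //=.
  by rewrite fset_uniq !inE eqxx.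
by move=> u; rewrite !inE; case: (eqVneq u v) => [->|].
Qed.

Lemma simplex_bdE (S : simplicial_complex T) n s : #|` s| = n.+2 ->
  (simplex_bd r S n s =
   \sum_(v <- s) (-1) ^+ index v (sort r s) *: fgen (is_nsimplex S n) (s `\ v)%fset)%R.
Proof.
move=> sn; pose F i (t : seq T) := ((-1) ^+ i *: fgen (is_nsimplex S n) [fset x in t]%fset)%R.
have us : uniq (sort r s) by rewrite sort_uniq fset_uniq.
have szs : size (sort r s) = n.+2 by rewrite size_sort.
have := sum_delete F us; rewrite szs /simplex_bd => ->.
rewrite (perm_big s) ?perm_sort //; apply: eq_bigr => v _; congr (_ *: fgen _ _)%R.
by apply/fsetP => x; rewrite !inE /= mem_rem_uniq // !inE mem_sort.
Qed.

End StrictOrder.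

(** * Sorting by position, and the sign relating the two vertex orders *)

Section Positions.
Variable (T : choiceType).
Implicit Types (s : {fset T * nat}) (u v : T * nat).

Definition pos_le : rel (T * nat) := fun u v => u.2 <= v.2.
Definition pos_lt : rel (T * nat) := fun u v => u.2 < v.2.

Lemma sorted_pos_ltE (t : seq (T * nat)) : sorted pos_lt t = sorted ltn (map snd t).
Proof. by rewrite sorted_map. Qed.


Lemma pos_lt_trans : transitive pos_lt.
Proof. by move=> u v w; apply: ltn_trans. Qed.

Lemma pos_lt_irr : irreflexive pos_lt.
Proof. by move=> u; apply: ltnn. Qed.

Lemma sorted_pos_lt s : {in s &, injective snd} -> sorted pos_lt (sort pos_le s).
Proof.
move=> inj; rewrite sorted_pos_ltE ltn_sorted_uniq_leq.
rewrite sorted_map sort_sorted; last by move=> u v; apply: leq_total.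
rewrite andbT map_inj_in_uniq ?sort_uniq ?fset_uniq //.
by move=> u v; rewrite !mem_sort; apply: inj.
Qed.

Lemma sort_pos_eq s t : sorted pos_lt t -> s =i t -> sort pos_le s = t.
Proof.
move=> srt st; apply: (irr_sorted_eq pos_lt_trans pos_lt_irr) => //.
  apply: sorted_pos_lt => u v; rewrite !st.
  have := srt; rewrite sorted_pos_ltE.
  move=> /(sorted_uniq ltn_trans ltnn) ut ut1 vt1 /eqP e.
  (* The entries of [t] have distinct positions, so equal positions mean equal indices in [t]. *)
  rewrite -(nth_index u ut1) -(nth_index u vt1) in e *.
  move: e; rewrite -!(nth_map _ 0 snd) ?index_mem // nth_uniq ?size_map ?index_mem //.
  by move=> /eqP ->.
by move=> u; rewrite mem_sort st.
Qed.

Lemma sort_pos_fsetD1 s v : {in s &, injective snd} ->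
  sort pos_le (s `\ v)%fset = rem v (sort pos_le s).
Proof.
move=> inj; apply: sort_pos_eq => [|u].
  exact: subseq_sorted pos_lt_trans _ _ (rem_subseq _ _) (sorted_pos_lt inj).
by rewrite mem_rem_uniq ?sort_uniq ?fset_uniq // !inE mem_sort.
Qed.

Lemma index_sort_pos s v : {in s &, injective snd} -> v \in s ->
  index v (sort pos_le s) = count (pos_lt^~ v) s.
Proof.
move=> inj vs; rewrite (@index_pairwise _ pos_lt) ?mem_sort //.
- by apply/permP; rewrite perm_sort.
- by move=> x y; rewrite /pos_lt -leqNgt => /ltnW.
by rewrite -sorted_pairwise ?sorted_pos_lt //; apply: pos_lt_trans.
Qed.

Variable r : total_order (T * nat)%type.

Definition pos_inv s : nat := inversions (ord_lt r) pos_lt s.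

(** The inversions lost with [v] are the pairs formed with the elements that precede [v] in exactly
    one of the two orders. Modulo 2 their number is the sum of the two indices of [v]. *)
Lemma pos_inv_fsetD1 s v : {in s &, injective snd} -> v \in s ->
  odd (pos_inv s) (+) odd (index v (sort r s)) =
  odd (pos_inv (s `\ v)%fset) (+) odd (index v (sort pos_le s)).
Proof.
move=> inj vs; have pm := perm_fsetD1 vs.
rewrite index_sort_ord // index_sort_pos // !(permP pm) /= ord_lt_irr pos_lt_irr.
rewrite /pos_inv (perm_inversions _ _ pm) -!oddD !add0n.
rewrite inversions_cons ?[LHS]oddD ?odd_double ?addbF //; first exact: ord_lt_irr.
  by move=> u; rewrite !inE => /andP[uv _]; rewrite ord_lt_total.
move=> u; rewrite !inE => /andP[uv us]; rewrite /pos_lt ltnNge leq_eqVlt negb_or.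
suff -> : u.2 != v.2 by [].
by apply: contraNneq uv => /inj ->.
Qed.

End Positions.

(** * Tuples, geodesics and positions *)

Section Placement.
Variable G : connected_graph.
Implicit Types (x y z a b : G) (s t : seq G) (u v : G * nat) (i j l : nat).

(** The position given to an entry is its cumulative length along the tuple, counted from [i] at
    [x]. *)
Fixpoint place x i s : seq (G * nat) :=
  if s is z :: s' then (z, i + dist x z) :: place z (i + dist x z) s' else [::].

Lemma map_fst_place x i s : map fst (place x i s) = s.
Proof. by elim: s x i => //= z s IH x i; rewrite IH. Qed.

Lemma place_rcons x i s z :
  place x i (rcons s z) = rcons (place x i s) (z, i + len (x :: rcons s z)).
Proof.
elim: s x i => [|y s IH] x i /=; first by rewrite addn0.
by rewrite IH /= addnA.
Qed.

Lemma path_place x i s : path (fun y z => y != z) x s ->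
  path (@pos_lt G) (x, i) (place x i s).
Proof.
elim: s x i => //= z s IH x i /andP[xz /IH ->]; rewrite andbT /pos_lt /=.
by have := dist_gt0 xz; lia.
Qed.

Lemma dist_adj x y : adj x y -> dist x y = 1.
Proof.
move=> xy; apply/eqP; rewrite eqn_leq dist_gt0 ?andbT.
  by apply: dist_le; exists [:: y]; rewrite /= xy.
by apply: contraTneq xy => ->; rewrite adj_irr.
Qed.

(** Geodesics between consecutive entries are concatenated, so each entry is met at the time equal
    to its cumulative length. *)
Lemma path_through c x i s : exists p,
  [/\ path (fun y z => dist y z == 1) x p, last x p = last x s,
      size p = len (x :: s) &
      {in place x i s, forall v, i <= v.2 /\ nth c (x :: p) (v.2 - i) = v.1}].
Proof.
elim: s x i => [|z s IH] x i; first by exists [::].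
have [q [qp ql qs]] := dist_walk x z.
have [p [pp pl ps pv]] := IH z (i + dist x z).
exists (q ++ p); split.
- rewrite cat_path ql pp andbT; apply: sub_path qp => y w /dist_adj -> //.
- by rewrite last_cat ql pl.
- by rewrite size_cat qs ps.
have nth_q j : nth c (x :: q ++ p) (dist x z + j) = nth c (z :: p) j.
  rewrite -qs -cat_cons; case: j => [|j].
    by rewrite addn0 nth_cat ltnS leqnn -last_nth ql.
  by rewrite nth_cat /= addnS ltnS ltnNge leq_addr subSS addKn.
move=> v; rewrite inE => /predU1P[->|/pv[iv vE]] /=.
  by rewrite leq_addr addKn -[dist x z]addn0 nth_q.
have le_iv := leq_trans (leq_addr _ _) iv.
by split; rewrite // -vE -nth_q subnDA subnKC // leq_subRL.
Qed.

(** The trace that a path with unit steps leaves on two successive marked vertices; it is all that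
    the length estimates use. *)
Definition short : rel (G * nat) := fun u v =>
  (u.2 < v.2) && (u.2 + dist u.1 v.1 <= v.2).

Lemma short_len u (t : seq (G * nat)) : path short u t ->
  u.2 + len (u.1 :: map fst t) <= (last u t).2.
Proof.
elim: t u => [|v t IH] u /=; first by rewrite addn0.
by move=> /andP[/andP[_ uv] /IH] /=; lia.
Qed.

(** The equality case of [short_len]: slack in one gap cannot be made up by the others. *)
Lemma short_place u (t : seq (G * nat)) : path short u t ->
  (last u t).2 <= u.2 + len (u.1 :: map fst t) ->
  t = place u.1 u.2 (map fst t) /\ path (fun y z => y != z) u.1 (map fst t).
Proof.
elim: t u => [|v t IH] u //= /andP[/andP[lt_uv uv] vt] le_last.
have := short_len vt; rewrite /= => le_v.
have vE : v.2 = u.2 + dist u.1 v.1 by lia.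
have [|tE neq] := IH _ vt; first by rewrite /=; lia.
rewrite -vE -tE neq andbT; split; first by rewrite -surjective_pairing.
(* Positions increase strictly, so a gap equal to a distance keeps the two vertices apart. *)
by apply: contraTneq lt_uv => e; rewrite vE e dist_xx addn0 ltnn.
Qed.

(* Past its end the path is continued by its last vertex, the default of nth. *)
Lemma dist_nth_path l a b p i j : is_path_le l a b p -> i <= j ->
  dist (nth b p i) (nth b p j) <= j - i.
Proof.
move=> /and4P[sz _ /eqP lst srt] /subnKC <-; rewrite addKn.
elim: (j - i) => [|k IH]; first by rewrite addn0 dist_xx.
apply: leq_trans (dist_triangle _ (nth b p (i + k)) _) _.
rewrite addnS -[k.+1]addn1 leq_add //.
have [lt_sz|le_sz] := ltnP (i + k).+1 (size p).
  by move/(sortedP b): srt => /(_ _ lt_sz) /eqP ->.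
rewrite [nth b p _.+1]nth_default //.
have [ge_sz|lt_sz] := leqP (size p) (i + k); first by rewrite nth_default // dist_xx.
have -> : i + k = (size p).-1 by lia.
by rewrite nth_last lst dist_xx.
Qed.

End Placement.

(** * Simplices outside K' and generators of the magnitude complex *)

Section Simplices.
Variables (G : connected_graph) (l : nat) (a b : G).
Hypothesis l_gt0 : 0 < l.
Implicit Types (s : {fset G * nat}).

Definition endpoint_tuple s : seq G := a :: rcons (positional s) b.

Lemma K_simplex_inj s : K_simplex l a b s -> {in s &, injective snd}.
Proof.
move=> [_ _ [p _ p_s]] [x i] [y j] /p_s[_ /= <-] /p_s[_ /= <-].
by move=> ->.
Qed.

Lemma K_short s : K_simplex l a b s ->
  path (@short G) (a, 0) (rcons (sort (@pos_le G) s) (b, l)).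
Proof.
move=> Ks; have [_ s_rng [p p_path p_s]] := Ks.
have [/andP[sz1 sz2] /eqP hd /eqP lst _] := and4P p_path.
(* The default [b] prolongs [p] constantly, so [(b, l)] lies on it even if [p] has length less than
   [l]. *)
pose onp (v : G * nat) := nth b p v.2 == v.1.
apply: (@sub_in_path _ onp (@pos_lt G)).
- move=> u v /eqP pu /eqP pv uv; apply/andP; split=> //.
  have le_uv : u.2 <= v.2 := ltnW uv.
  by rewrite -(leq_subRL _ le_uv) -pu -pv (dist_nth_path p_path).
- rewrite /= all_rcons /onp /= nth0; apply/and3P; split.
  + by case: (p) sz1 hd => //= y q _ ->.
  + have [lt_sz|?] := ltnP l (size p); last by rewrite nth_default.
    have -> : l = (size p).-1 by lia.
    by rewrite nth_last lst.
  + apply/allP => v; rewrite mem_sort => /p_s[sz <-].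
    by apply/eqP/set_nth_default; apply: ltnW.
rewrite rcons_path (path_sortedE (@pos_lt_trans G)) sorted_pos_lt; last first.
  exact: K_simplex_inj Ks.
have rng (v : G * nat) : v \in sort (@pos_le G) s -> 0 < v.2 < l.
  by rewrite mem_sort => /s_rng; lia.
rewrite andbT; apply/andP; split; first by apply/allP => v /rng /andP[].
have := mem_last (a, 0) (sort (@pos_le G) s); rewrite inE /pos_lt.
by move=> /predU1P[->|/rng /andP[]].
Qed.

Lemma K_len_le s : K_simplex l a b s -> len (endpoint_tuple s) <= l.
Proof.
by move=> /K_short/short_len; rewrite last_rcons map_rcons.
Qed.

Lemma K_place s : K_simplex l a b s -> len (endpoint_tuple s) = l ->
  sort (@pos_le G) s = place a 0 (positional s).
Proof.
move=> /K_short/short_place; rewrite last_rcons map_rcons /= => h ls.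
have [] := h; first by rewrite add0n -[X in X <= _]ls.
by rewrite place_rcons => /rcons_inj[].
Qed.

Lemma K_mctuple n s : K_simplex l a b s -> #|` s| = n.+1 ->
  is_mctuple l a b n.+2 (endpoint_tuple s) = (len (endpoint_tuple s) == l).
Proof.
move=> Ks sn; rewrite /is_mctuple; case: (len _ =P l) => [ls|]; last by rewrite !andbF.
rewrite /= last_rcons size_rcons size_map size_sort sn !eqxx andbT /=.
have := short_place (K_short Ks); rewrite last_rcons map_rcons /= add0n.
by case=> //; rewrite -[X in X <= _]ls.
Qed.

Lemma K'_simplexE s : K'_simplex l a b s <->
  K_simplex l a b s /\ len (endpoint_tuple s) != l.
Proof.
split=> [[Ks le]|[Ks neq]]; split=> //.
  by apply/eqP; move: le; rewrite /endpoint_tuple; lia.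
by have := K_len_le Ks; move: neq; rewrite /endpoint_tuple; lia.
Qed.

(** On [a :: rcons y b] the list being placed is [y]: both endpoints are stripped. *)
Definition simplex_of (t : seq G) : {fset G * nat} :=
  [fset v in place a 0 (behead (belast a (behead t)))]%fset.

Lemma simplex_ofK n t : is_mctuple l a b n.+2 t ->
  [/\ K_simplex l a b (simplex_of t), #|` simplex_of t| = n.+1 &
      endpoint_tuple (simplex_of t) = t].
Proof.
case: t => [|x t]; first by move=> /andP[].
case: (lastP t) => [|y z]; first by move=> /andP[].
move=> /and5P[/eqP]; rewrite /= size_rcons last_rcons => -[sz] /eqP-> /eqP-> neq /eqP ln.
have {}ln : len (a :: rcons y b) = l by exact: ln.
(* Cumulative lengths increase strictly from 0 at [a] to [l] at [b], so the interior positions lie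
   strictly between. *)
have := path_place 0 neq; rewrite place_rcons ln add0n.
rewrite (path_sortedE (@pos_lt_trans G)) all_rcons => /andP[/andP[_ pos]].
rewrite (sorted_pairwise (@pos_lt_trans G)) pairwise_rcons.
rewrite -(sorted_pairwise (@pos_lt_trans G)) => /andP[lt_l srt].
have sE : sort (@pos_le G) (simplex_of (a :: rcons y b)) = place a 0 y.
  by apply: sort_pos_eq => // v; rewrite inE /simplex_of /= belast_rcons.
have szE : #|` simplex_of (a :: rcons y b)| = n.+1.
  by rewrite -(size_sort (@pos_le G)) sE -sz -[in RHS](map_fst_place a 0 y) size_map.
split=> //; last by rewrite /endpoint_tuple /positional sE map_fst_place.
(* The path witnessing membership in K is a concatenation of geodesics through the tuple, of length
   exactly [l]. *)
have [p [pp pl ps pv]] := path_through a a 0 (rcons y b).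
have memE v : (v \in simplex_of (a :: rcons y b)) = (v \in place a 0 y).
  by rewrite -sE mem_sort.
split; first by rewrite -cardfs_gt0 szE.
  move=> v; rewrite memE => vy; have := allP pos _ vy; rewrite /pos_lt /= => ->.
  by have := allP lt_l _ vy; rewrite /pos_lt /=; lia.
exists (a :: p).
  by rewrite /is_path_le /= ps pl last_rcons !eqxx ln !ltnS l_gt0 leqnn pp.
move=> v; rewrite memE => vy; split; first by rewrite /= ps ln ltnS; exact: (allP lt_l).
have [|_] := pv v; first by rewrite place_rcons mem_rcons inE vy orbT.
by rewrite subn0.
Qed.

Lemma endpoint_tupleK s : K_simplex l a b s -> len (endpoint_tuple s) = l ->
  simplex_of (endpoint_tuple s) = s.
Proof.
move=> Ks ls; rewrite /simplex_of /endpoint_tuple /= belast_rcons /= -K_place //.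
by apply/fsetP => v; rewrite !inE mem_sort.
Qed.

End Simplices.

(** * The isomorphism of chain complexes *)

Lemma delete_map (T U : Type) (f : T -> U) i (s : seq T) :
  delete i (map f s) = map f (delete i s).
Proof. by rewrite /delete map_cat map_take map_drop. Qed.

Lemma delete_cons_rcons (T : Type) i (s : seq T) x y : i < size s ->
  delete i.+1 (x :: rcons s y) = x :: rcons (delete i s) y.
Proof.
move=> lt_i; rewrite /delete /= -!cats1 take_cat lt_i drop_cat -catA.
case: ltnP => // le_sz; have -> : i.+1 = size s by lia.
by rewrite subnn drop_size.
Qed.

Section RelativeChains.
Local Open Scope ring_scope.
Variables (G : connected_graph) (l : nat) (a b : G).
Variable r : total_order (G * nat)%type.
Hypothesis l_gt0 : (0 < l)%N.
Implicit Types (s : {fset G * nat}) (n : nat).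

Local Notation K := (K_complex l a b).
Local Notation K' := (K'_complex l a b).
Local Notation P := (K_pair l a b).
Local Notation mc := (is_mctuple l a b).
Local Notation tuple := (endpoint_tuple a b).

(** The term [n] accounts for one sign per degree: the vertex of rank [i] by position is entry
    [i.+1] of the tuple. *)
Definition pos_sign n s : int := (-1) ^+ (pos_inv r s + n).

Lemma pos_signK n s (V : lmodType int) (x : V) :
  pos_sign n s *: (pos_sign n s *: x) = x.
Proof. by rewrite scalerA -expr2 sqrr_sign scale1r. Qed.

(** Defined on all of C(K); the default value 0 of [fgen] is what makes it vanish on the simplices
    of K'. *)
Definition simplex_tuple n :
    {freeg (nsimplex K n) / int} -> {freeg (mctuple l a b n.+2) / int} :=
  flift (fun s : nsimplex K n => pos_sign n (val s) *: fgen (mc n.+2) (tuple (val s))).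

HB.instance Definition _ n := GRing.isZmodMorphism.Build
  {freeg (nsimplex K n) / int} {freeg (mctuple l a b n.+2) / int}
  (@simplex_tuple n) (flift_additive _).

Definition tuple_simplex n :
    {freeg (mctuple l a b n.+2) / int} -> {freeg (nsimplex K n) / int} :=
  flift (fun t : mctuple l a b n.+2 =>
    pos_sign n (simplex_of a (val t)) *: fgen (is_nsimplex K n) (simplex_of a (val t))).

HB.instance Definition _ n := GRing.isZmodMorphism.Build
  {freeg (mctuple l a b n.+2) / int} {freeg (nsimplex K n) / int}
  (@tuple_simplex n) (flift_additive _).

Lemma simplex_tuple_fgen n s : is_nsimplex K n s ->
  simplex_tuple (fgen (is_nsimplex K n) s) = pos_sign n s *: fgen (mc n.+2) (tuple s).
Proof.
move=> Ks; rewrite /simplex_tuple (@flift_fgen _ _ _ _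
  (fun s => pos_sign n s *: fgen (mc n.+2) (tuple s))) //.
by rewrite Ks.
Qed.

Lemma tuple_simplex_fgen n t : mc n.+2 t ->
  tuple_simplex (fgen (mc n.+2) t) =
  pos_sign n (simplex_of a t) *: fgen (is_nsimplex K n) (simplex_of a t).
Proof.
move=> mt; rewrite /tuple_simplex (@flift_fgen _ _ _ _
  (fun t => pos_sign n (simplex_of a t) *:
     fgen (is_nsimplex K n) (simplex_of a t))) //.
by rewrite mt.
Qed.

Lemma nsimplexP n s : reflect (K_simplex l a b s /\ #|` s| = n.+1) (is_nsimplex K n s).
Proof. by apply: (iffP andP) => -[/asboolP Ks /eqP sn]. Qed.

Lemma nsimplex_mctuple n s : is_nsimplex K n s -> mc n.+2 (tuple s) = ~~ is_nsimplex K' n s.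
Proof.
move=> /nsimplexP[Ks sn]; rewrite (K_mctuple l_gt0 Ks sn).
rewrite /is_nsimplex sn eqxx andbT; apply/idP/idP.
  by move=> /eqP ls; apply/negP => /asboolP/(K'_simplexE _ _ l_gt0)[_]; rewrite ls eqxx.
by apply: contraNT => neq; apply/asboolP/(K'_simplexE _ _ l_gt0).
Qed.

(** By [mcfaceE] the collinearity test is absorbed into the default 0 of [fgen], so every vertex of
    [s] contributes a term. *)
Lemma mctuple_bd_tuple n s : is_nsimplex K n.+1 s -> mc n.+3 (tuple s) ->
  mctuple_bd l a b n.+2 (tuple s) =
  \sum_(v <- s) (-1) ^+ (index v (sort (@pos_le G) s)).+1 *:
    fgen (mc n.+2) (tuple (s `\ v)%fset).
Proof.
move=> /nsimplexP[Ks sn] ms; rewrite /mctuple_bd big_add1 big_mkord.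
pose F i (t : seq (G * nat)) :=
  (-1) ^+ i.+1 *: fgen (mc n.+2) (a :: rcons (map fst t) b) : {freeg _ / int}.
have us : uniq (sort (@pos_le G) s) by rewrite sort_uniq fset_uniq.
have szs : size (sort (@pos_le G) s) = n.+2 by rewrite size_sort.
transitivity (\sum_(i < n.+2) F i (delete i (sort (@pos_le G) s))).
  apply: eq_bigr => i _; have i_lt := ltn_ord i.
  by rewrite mcfaceE //= delete_cons_rcons ?size_map ?szs // delete_map.
have := sum_delete F us; rewrite szs => ->; rewrite (perm_big s) ?perm_sort //=.
rewrite big_seq [RHS]big_seq; apply: eq_bigr => v vs.
by rewrite /F -sort_pos_fsetD1 //; apply: K_simplex_inj Ks.
Qed.

Lemma nsimplex_fsetD1 (T : choiceType) (S : simplicial_complex T) n (s : {fset T}) v :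
  is_nsimplex S n.+1 s -> v \in s -> is_nsimplex S n (s `\ v)%fset.
Proof.
move=> /andP[Ss sn] vs.
have sn' : #|` (s `\ v)%fset| = n.+1 by move: sn; rewrite (cardfsD1 v) vs; lia.
rewrite /is_nsimplex sn' eqxx andbT; apply: (simplex_face Ss); first exact: fsubD1set.
by rewrite -cardfs_gt0 sn'.
Qed.

Lemma simplex_tuple_bd n (x : {freeg (nsimplex K n.+1) / int}) :
  simplex_tuple (schain_bd r x) = mc_bd (simplex_tuple x).
Proof.
pose f : {additive {freeg (nsimplex K n.+1) / int} ->
  {freeg (mctuple l a b n.+2) / int}} := @simplex_tuple n \o @schain_bd _ r K n.
pose g : {additive {freeg (nsimplex K n.+1) / int} ->
  {freeg (mctuple l a b n.+2) / int}} := @mc_bd G l a b n.+2 \o @simplex_tuple n.+1.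
apply: (@freeg_additive_ext _ _ f g) => {x} -[s Ks]; rewrite /f /g /=.
have [Ks' sn] := nsimplexP _ _ Ks.
rewrite schain_bdU /= simplex_bdE // raddf_sum /simplex_tuple fliftU /=.
rewrite raddfZsign /= mc_bd_fgen; case: ifPn => ms.
  rewrite mctuple_bd_tuple // scaler_sumr big_seq [RHS]big_seq.
  apply: eq_bigr => v vs; rewrite raddfZsign /= simplex_tuple_fgen; last first.
    exact: nsimplex_fsetD1.
  rewrite !scalerA /pos_sign -!exprD -signr_odd -[in RHS]signr_odd.
  have := pos_inv_fsetD1 r (K_simplex_inj Ks') vs.
  rewrite !oddD /= => parity; congr (_ ^+ nat_of_bool _ *: _).
  by move: parity; do 5!case: (odd _).
(* Here [s] is in K', hence so are its faces, and both sides vanish. *)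
rewrite scaler0 big_seq big1 // => v vs.
have K's : is_nsimplex K' n.+1 s by rewrite -[_ _ _]negbK -nsimplex_mctuple.
rewrite raddfZsign /= simplex_tuple_fgen ?nsimplex_fsetD1 // fgenN ?scaler0 //.
by rewrite nsimplex_mctuple ?negbK nsimplex_fsetD1.
Qed.

Lemma tuple_simplexK n (x : {freeg (mctuple l a b n.+2) / int}) :
  simplex_tuple (tuple_simplex x) = x.
Proof.
pose f : {additive {freeg (mctuple l a b n.+2) / int} ->
  {freeg (mctuple l a b n.+2) / int}} := @simplex_tuple n \o @tuple_simplex n.
pose g : {additive {freeg (mctuple l a b n.+2) / int} ->
  {freeg (mctuple l a b n.+2) / int}} := idfun.
apply: (@freeg_additive_ext _ _ f g) => {x} t; rewrite /f /g /=.
have [Ks sn tE] := simplex_ofK l_gt0 (valP t).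
rewrite -(fgen_val t) tuple_simplex_fgen ?(valP t) // raddfZsign /=.
rewrite simplex_tuple_fgen; last exact/nsimplexP.
by rewrite tE pos_signK.
Qed.

Lemma simplex_tuple_fgenK n s : is_nsimplex K n s -> ~~ is_nsimplex K' n s ->
  tuple_simplex (simplex_tuple (fgen (is_nsimplex K n) s)) = fgen (is_nsimplex K n) s.
Proof.
move=> Ks; rewrite -(nsimplex_mctuple Ks) => ms.
rewrite simplex_tuple_fgen // raddfZsign /= tuple_simplex_fgen //.
have /nsimplexP[K_s _] := Ks; have /and5P[_ _ _ _ /eqP ls] := ms.
by rewrite (endpoint_tupleK l_gt0) // pos_signK.
Qed.

Local Notation incl :=
  (@ChainMap (schain r K') (schain r K) (fun n => @schain_incl _ P n)
     (@schain_incl_bd _ r P)).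

HB.instance Definition _ n := GRing.isZmodMorphism.Build _ _
  (@coker_pi _ _ incl n) (@coker_pi_sub _ _ incl n).

Lemma simplex_tupleK n (x : {freeg (nsimplex K n) / int}) :
  coker_pi incl (tuple_simplex (simplex_tuple x)) = coker_pi incl x.
Proof.
pose f : {additive {freeg (nsimplex K n) / int} -> coker incl n} :=
  @coker_pi _ _ incl n \o (@tuple_simplex n \o @simplex_tuple n).
pose g : {additive {freeg (nsimplex K n) / int} -> coker incl n} :=
  @coker_pi _ _ incl n.
apply: (@freeg_additive_ext _ _ f g) => {x} s; rewrite /f /g /=.
rewrite -(fgen_val s); case: (boolP (is_nsimplex K' n (val s))) => K's; last first.
  by rewrite simplex_tuple_fgenK ?(valP s).
(* A simplex of K' is sent to 0, and its class in the quotient is 0 as well. *)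
rewrite simplex_tuple_fgen ?(valP s) // fgenN; last first.
  by rewrite nsimplex_mctuple ?(valP s) // negbK.
rewrite scaler0 raddf0; symmetry.
apply: (@coker_pi_eq _ _ incl n); rewrite subr0; apply/asboolP.
exists (fgen (is_nsimplex K' n) (val s)).
by have := @schain_incl_fgen _ P n (val s); rewrite ifT => [<-|].
Qed.

Lemma simplex_tuple_incl n (y : {freeg (nsimplex K' n) / int}) :
  simplex_tuple (@schain_incl _ P n y) = 0.
Proof.
pose f : {additive {freeg (nsimplex K' n) / int} ->
  {freeg (mctuple l a b n.+2) / int}} := @simplex_tuple n \o @schain_incl _ P n.
pose g : {additive {freeg (nsimplex K' n) / int} ->
  {freeg (mctuple l a b n.+2) / int}} := \0.
apply: (@freeg_additive_ext _ _ f g) => {y} s; rewrite /f /g /=.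
have Ks := @is_nsimplex_sub _ P _ _ (valP s).
rewrite (congr1 (@simplex_tuple n) (@schain_inclU _ P n s)).
rewrite simplex_tuple_fgen // fgenN ?scaler0 //.
by rewrite nsimplex_mctuple // negbK (valP s).
Qed.

(** The choice of representative is harmless because [simplex_tuple] vanishes on C(K'). *)
Definition coker_tuple n (z : coker incl n) : {freeg (mctuple l a b n.+2) / int} :=
  simplex_tuple (repr z).

Lemma coker_tuple_pi n (x : {freeg (nsimplex K n) / int}) :
  coker_tuple (coker_pi incl x) = simplex_tuple x.
Proof.
apply/eqP; rewrite -subr_eq0 -raddfB.
have : (repr (coker_pi incl x) - x) \in @in_image _ _ incl n.
  by rewrite Quotient.idealrBE /coker_pi; rewrite reprK.
rewrite unfold_in => /asboolP[y ->]; apply/eqP; exact: simplex_tuple_incl.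
Qed.

Lemma coker_tuple_additive n : zmod_morphism (@coker_tuple n).
Proof.
move=> x y; rewrite -{1}[x]coker_repr -{1}[y]coker_repr.
by rewrite -coker_pi_sub coker_tuple_pi raddfB.
Qed.
HB.instance Definition _ n := GRing.isZmodMorphism.Build
  (coker incl n) {freeg (mctuple l a b n.+2) / int}
  (@coker_tuple n) (@coker_tuple_additive n).

Lemma coker_tuple_bij n : bijective (@coker_tuple n).
Proof.
exists (fun x => coker_pi incl (tuple_simplex x)) => [z|x].
  by rewrite -[RHS]coker_repr -[RHS]simplex_tupleK.
by rewrite coker_tuple_pi tuple_simplexK.
Qed.

Lemma coker_tuple_bd n (z : coker incl n.+1) :
  coker_tuple (coker_bd z) = mc_bd (coker_tuple z).
Proof.
by rewrite -[z]coker_repr coker_bd_pi !coker_tuple_pi; apply: simplex_tuple_bd.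
Qed.

Lemma relative_schain_iso : chain_iso (relative_schain r P) (shift2 (MC l a b)).
Proof.
exists (fun n => (@coker_tuple n :
  {additive coker incl n -> {freeg (mctuple l a b n.+2) / int}})).
split=> [n|n z]; first exact: coker_tuple_bij.
exact: coker_tuple_bd.
Qed.

Lemma homology_relative_MH n :
  zmod_iso (homology (relative_schain r P) n.+1) (MH n.+3 l a b).
Proof.
have [f [f_bij f_bd]] := relative_schain_iso.
apply: (@homology_iso _ (MC l a b) n.+1 n.+3 (f n.+1) (f n.+2)) => [|||z].
- exact: f_bij.
- exact: f_bij.
- exact: f_bd.
transitivity (f n (bd (relative_schain r P) n z) == 0); first by rewrite f_bd.
by rewrite raddf_eq0 //; exact: (bij_inj (f_bij n)).
Qed.

(** The only candidate generator is the pair (a, b), whose length is d(a,b). *)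
Lemma mctuple1_eq0 (x : {freeg (mctuple l a b 1) / int}) : (dist a b != l) -> x = 0.
Proof.
move=> ab; pose z : {additive {freeg (mctuple l a b 1) / int} ->
  {freeg (mctuple l a b 1) / int}} := \0.
apply: (@freeg_additive_ext _ _ idfun z) => {x} -[[|x [|y []]] // ms]; exfalso.
have /and5P[_ /eqP/= xa /eqP/= yb _ /eqP] := ms.
by move: ab; rewrite /= addn0 xa yb => /eqP.
Qed.

(** All 0-chains are cycles by convention, and all 2-chains of MC are cycles because MC in degree 1
    is zero. *)
Lemma homology_relative_MH2 : (dist a b < l)%N ->
  zmod_iso (homology (relative_schain r P) 0) (MH 2 l a b).
Proof.
move=> lt_l; have [f [f_bij f_bd]] := relative_schain_iso.
apply: (@homology_iso _ (MC l a b) 0 2 (f 0) (f 1)) => [|||z].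
- exact: f_bij.
- exact: f_bij.
- exact: f_bd.
by apply/eqP/mctuple1_eq0; rewrite ltn_eqF.
Qed.

(** * Degree 2 when d(a,b) = l *)

Section Geodesic.
Hypothesis dist_ab : dist a b = l.

(** Any tuple from [a] to [b] has length at least d(a,b) = l, above the bound l - 1 defining K'. *)
Lemma K'_empty n s : ~~ is_nsimplex K' n s.
Proof.
apply/negP => /andP[/asboolP[_]].
have := len_subseq a b (sub0seq (positional s)).
by rewrite /= addn0 dist_ab; lia.
Qed.

Lemma simplex_tuple_bij n : bijective (@simplex_tuple n).
Proof.
exists (@tuple_simplex n); last exact: tuple_simplexK.
pose f : {additive {freeg (nsimplex K n) / int} -> {freeg (nsimplex K n) / int}} :=
  @tuple_simplex n \o @simplex_tuple n.
apply: (@freeg_additive_ext _ _ f idfun) => s; rewrite /f /=.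
by rewrite -(fgen_val s) simplex_tuple_fgenK ?(valP s) ?K'_empty.
Qed.

Lemma mctuple_ab : mc 1 [:: a; b].
Proof.
rewrite /is_mctuple /= addn0 dist_ab !eqxx !andbT /=.
by apply: contraTneq l_gt0 => ab; rewrite -dist_ab ab dist_xx.
Qed.

(** A vertex (x, i) goes to (a, x, b) with sign +1, and the single interior deletion, at index 1,
    gives -(a, b). *)
Lemma mc_bd_simplex_tuple0 (x : {freeg (nsimplex K 0) / int}) :
  mc_bd (simplex_tuple x) = - (fgen (mc 1) [:: a; b] *~ deg x).
Proof.
pose f : {additive {freeg (nsimplex K 0) / int} -> {freeg (mctuple l a b 1) / int}} :=
  @mc_bd G l a b 1 \o @simplex_tuple 0.
pose g : {additive {freeg (nsimplex K 0) / int} -> {freeg (mctuple l a b 1) / int}} :=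
  -%R \o (intmul (fgen (mc 1) [:: a; b]) \o @deg (nsimplex K 0)).
apply: (@freeg_additive_ext _ _ f g) => {x} -[s Ks]; rewrite /f /g /=.
have [_ /eqP/cardfs1P[v sE]] := nsimplexP _ _ Ks.
have ms : mc 2 (tuple s) by rewrite nsimplex_mctuple ?K'_empty.
have tE : tuple s = [:: a; v.1; b].
  rewrite /endpoint_tuple /positional (@sort_pos_eq _ _ [:: v]) //.
  by move=> u; rewrite sE !inE.
rewrite degU mulr1z /simplex_tuple fliftU /= raddfZsign /= mc_bd_fgen ms.
rewrite /mctuple_bd big_nat1 mcfaceE // tE /pos_sign /pos_inv /inversions.
by rewrite sE !big_seq_fset1 ord_lt_irr scale1r scaleN1r.
Qed.

Lemma reduced_homology_MH2 : zmod_iso (reduced_homology r K 0) (MH 2 l a b).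
Proof.
apply: (@homology_iso (augmented r K) (MC l a b) 1 2
  (@simplex_tuple 0) (@simplex_tuple 1)) => [|||x].
- exact: simplex_tuple_bij.
- exact: simplex_tuple_bij.
- exact: simplex_tuple_bd.
rewrite /= mc_bd_simplex_tuple0 oppr_eq0.
(* The pair (a, b) is a basis element of MC in degree 1, so taking degrees recovers the integer
   [deg x]. *)
apply/eqP/eqP => [/(congr1 (@deg _))|->]; last by rewrite mulr0z.
by rewrite raddfMz /fgen insubT ?mctuple_ab //= => ms; rewrite degU deg0 -mulrzl mulr1 intz.
Qed.

End Geodesic.
End RelativeChains.

Theorem theorem1 (G : connected_graph) (a b : G) (l : nat)
    (r : total_order (G * nat)%type) (hl : 3 <= l) :
  [/\ chain_iso (relative_schain r (K_pair l a b)) (shift2 (MC l a b)),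
      forall k : nat, 3 <= k ->
        zmod_iso (MH k l a b)
                 (homology (relative_schain r (K_pair l a b)) (k - 2)),
      dist a b < l ->
        zmod_iso (MH 2 l a b) (homology (relative_schain r (K_pair l a b)) 0)
    & dist a b = l ->
        zmod_iso (MH 2 l a b) (reduced_homology r (K_complex l a b) 0)].
Proof.
have l_gt0 : 0 < l := ltnW (ltnW hl).
split=> [|[|[|[|k]]] //|lt_l|eq_l].
- exact: relative_schain_iso.
- by move=> _; rewrite !subSS subn0; apply/zmod_iso_sym/homology_relative_MH.
- exact/zmod_iso_sym/homology_relative_MH2.
- exact/zmod_iso_sym/reduced_homology_MH2.
Qed.
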